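(* Let $\mathcal{K}\subseteq\mathsf{REL}$ and let $t,u,w$ be $\mathrm{PCoR}_{\{{}^*,\overline{\mathrm{I}},\overline{x}\}}$ terms. If $\mathcal{K}$ is submodel-closed and $\mathcal{K}\models w^{\circlearrowleft}\le T_{w^{\circlearrowleft}}(w^{\circlearrowleft})$, then $$\mathcal{K}_{w\ge\mathrm{I}}\models t\le u\quad\Longleftrightarrow\quad \mathcal{K}\models T_{w^{\circlearrowleft}}(t)\le u.$$
   Context: Variables form a countably infinite set $\mathbf{V}$. $\mathrm{PCoR}_{\{{}^*,\overline{\mathrm{I}},\overline{x}\}}$ terms are built from variables and constants $\mathrm{I}$ (identity), $0$, $\top$ (full relation), $\overline{\mathrm{I}}$ (complement of identity) using $;$, $+$ (union), $\cap$, ${}^{\smile}$ (converse), ${}^*$ (reflexive transitive closure), and complement $\overline{x}$ of variables; $t^{\circlearrowleft}:=t\cap\mathrm{I}$. A valuation $v$ over a nonempty set $B$ maps variables to binary relations on $B$, extended relationally to $\hat v$. $\mathsf{REL}$ is the class of all valuations. For a class $\mathcal{K}$, $\mathcal{K}\models t\le u$ means $\hat v(t)\subseteq\hat v(u)$ for all $v\in\mathcal{K}$; $\mathcal{K}_{w\ge\mathrm{I}}$ is the class of $v\in\mathcal{K}$ with $\hat v(\mathrm{I})\subseteq\hat v(w)$. For $v$ over $A$ and nonempty $B\subseteq A$, the submodel $v\restriction B$ maps each variable $x$ to $v(x)\cap B^2$; $\mathcal{K}$ is submodel-closed if $v\in\mathcal{K}$ implies $v\restriction B\in\mathcal{K}$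 for every nonempty subset $B$ of the base set of $v$. For terms $t$, $z$ define $T_z(t)$ by: $T_z(a)=z;a;z$ for $a$ a variable, a complemented variable $\overline{x}$, $\overline{\mathrm{I}}$, $\top$ or $\mathrm{I}$; $T_z(0)=0$; $T_z(t^{\smile})=T_z(t)^{\smile}$; $T_z(t\cap s)=T_z(t)\cap T_z(s)$; $T_z(t+s)=T_z(t)+T_z(s)$; $T_z(t;s)=T_z(t);T_z(s)$; $T_z(t^* )=T_z(t)^*;z$. *)

(* Defs.v *)
From Stdlib Require Export Relations.

Definition var := nat.

Inductive term : Type :=
  | Var (x : var)
  | VarC (x : var) (* complement of the variable x *)
  | Id
  | IdC            (* complement of the identity *)
  | Zero
  | Top
  | Comp (t s : term)
  | Union (t s : term)
  | Inter (t s : term)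
  | Conv (t : term)
  | Star (t : term).

Definition loop (t : term) : term := Inter t Id.

Record valuation : Type := Valuation {
  base : Type;
  base_nonempty : inhabited base;
  interp : var -> relation base }.

Fixpoint eval (v : valuation) (t : term) : relation (base v) :=
  match t with
  | Var x => interp v x
  | VarC x => fun a b => ~ interp v x a b
  | Id => fun a b => a = b
  | IdC => fun a b => a <> b
  | Zero => fun _ _ => False
  | Top => fun _ _ => True
  | Comp t s => fun a b => exists c, eval v t a c /\ eval v s c b
  | Union t s => fun a b => eval v t a b \/ eval v s a b
  | Inter t s => fun a b => eval v t a b /\ eval v s a b
  | Conv t => fun a b => eval v t b a
  | Star t => clos_refl_trans (base v) (eval v t)
  end.

(* A class of valuations; [fun _ => True] is the class of all of them. *)
Definition vclass := valuation -> Prop.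

Definition models (K : vclass) (t u : term) : Prop :=
  forall v, K v -> inclusion (base v) (eval v t) (eval v u).

Definition class_ge_id (K : vclass) (w : term) : vclass :=
  fun v => K v /\ inclusion (base v) (eval v Id) (eval v w).

(* A subset of the base is a predicate [B]; the submodel lives on the subset
   type [{a | B a}], where intersecting with B x B is just restriction. *)
Definition submodel (v : valuation) (B : base v -> Prop) (hB : exists a, B a) :
    valuation :=
  {| base := {a | B a};
     base_nonempty := let '(ex_intro _ a ha) := hB in inhabits (exist B a ha);
     interp x := fun a b => interp v x (proj1_sig a) (proj1_sig b) |}.

Definition submodel_closed (K : vclass) : Prop :=
  forall v, K v ->
  forall (B : base v -> Prop) (hB : exists a, B a), K (submodel v B hB).

Fixpoint T (z t : term) : term :=
  match t with
  | Var _ | VarC _ | Id | IdC | Top => Comp (Comp z t) z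
  | Zero => Zero
  | Comp t s => Comp (T z t) (T z s)
  | Union t s => Union (T z t) (T z s)
  | Inter t s => Inter (T z t) (T z s)
  | Conv t => Conv (T z t)
  | Star t => Comp (Star (T z t)) z
  end.

(* Main.v *)
(* The relation of [loop w] is the identity on [B = {a | w a a}], so
   [T (loop w) t] is bounded by the value of [t] in the submodel on [B], and
   values in that submodel are contained in values in the whole model, because
   complement only occurs on atoms.  The hypothesis on [loop w] says exactly
   that [w] stays reflexive in that submodel. *)
From Stdlib Require Import ProofIrrelevance.
Require Import Defs.

Lemma eval_submodel (v : valuation) (B : base v -> Prop) (hB : exists a, B a)
    (t : term) (a b : {a | B a}) :
  eval (submodel v B hB) t a b -> eval v t (proj1_sig a) (proj1_sig b).
Proof.
  revert a b; induction t; simpl; intros a b H; auto.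
  - now subst.
  (* Points of the subset type with equal projections are equal, by proof irrelevance; so
     distinctness survives projection. *)
  - intros E; apply H. destruct a as [a ha], b as [b hb]; simpl in E; subst.
    f_equal; apply proof_irrelevance.
  - destruct H as [c [H1 H2]]; exists (proj1_sig c); auto.
  - destruct H; auto.
  - destruct H; auto.
  - induction H.
    + now apply rt_step, IHt.
    + apply rt_refl.
    + eapply rt_trans; eassumption.
Qed.

(** [T] guards every atom by [loop w] on both sides; for [Star], the trailing [loop w] covers the
    empty iteration. *)
Lemma eval_T_domain (v : valuation) (w t : term) (a b : base v) :
  eval v (T (loop w) t) a b -> eval v w a a /\ eval v w b b.
Proof.
  revert a b; induction t; simpl; intros a b H;
    try (destruct H as [c [[d [[H1 E1] _]] [H2 E2]]]; subst; auto; fail).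
  - contradiction.
  - destruct H as [c [H1 H2]].
    split; [apply (IHt1 _ _ H1) | apply (IHt2 _ _ H2)].
  - destruct H; auto.
  - destruct H; auto.
  - apply and_comm; auto.
  - destruct H as [c [H1 [H2 E]]]; subst c; split; auto.
    apply clos_rt_rt1n in H1; destruct H1; auto.
    now apply (IHt _ _ H).
Qed.

Lemma eval_T_submodel (v : valuation) (w : term)
    (hB : exists a, eval v w a a) (t : term) (a b : {a | eval v w a a}) :
  eval v (T (loop w) t) (proj1_sig a) (proj1_sig b) ->
  eval (submodel v (fun a => eval v w a a) hB) t a b.
Proof.
  revert a b; induction t; simpl; intros a b H; auto.
  - destruct H as [c [[d [[_ E1] H]] [_ E2]]]; now subst.
  - destruct H as [c [[d [[_ E1] H]] [_ E2]]]; now subst.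
  - destruct H as [c [[d [[_ E1] H]] [_ E2]]]; subst.
    destruct a as [a ha], b as [b hb]; simpl in *; subst.
    f_equal; apply proof_irrelevance.
  - destruct H as [c [[d [[_ E1] H]] [_ E2]]]; subst.
    intros E; apply H; now rewrite E.
  - destruct H as [c [H1 H2]].
    exists (exist (fun a => eval v w a a) c (proj1 (eval_T_domain _ _ _ _ _ H2))); auto.
  - destruct H; auto.
  - destruct H; auto.
  - destruct H as [c [H1 [_ E]]]; subst c.
    destruct a as [a ha], b as [b hb]; simpl in H1.
    (* Each intermediate point of the path lies in the subset by [eval_T_domain], so the path lifts
       step by step. *)
    apply clos_rt_rt1n in H1; revert ha hb; induction H1 as [a | a c b H H1 IH];
      intros ha hb.
    + rewrite (proof_irrelevance _ ha hb); apply rt_refl.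
    + set (hc := proj2 (eval_T_domain _ _ _ _ _ H)).
      apply rt_trans with (exist (fun a => eval v w a a) c hc); [| apply IH].
      now apply rt_step, IHt.
Qed.

(** When [z] is reflexive, every guard can be passed by staying in place. *)
Lemma eval_T_full (v : valuation) (z t : term) :
  (forall a, eval v z a a) ->
  inclusion (base v) (eval v t) (eval v (T z t)).
Proof.
  intros hz; unfold inclusion; induction t; simpl; intros a b H;
    try (exists b; split; auto; exists a; split; auto; fail); auto.
  - destruct H as [c [H1 H2]]; exists c; auto.
  - destruct H; auto.
  - destruct H; auto.
  - exists b; split; auto.
    induction H.
    + now apply rt_step, IHt.
    + apply rt_refl.
    + eapply rt_trans; eassumption.
Qed.

Theorem theorem31 (K : vclass) (t u w : term)
  (hsub : submodel_closed K)
  (hw : models K (loop w) (T (loop w) (loop w))) :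
  models (class_ge_id K w) t u <-> models K (T (loop w) t) u.
Proof.
  split.
  - intros H v Kv a b Hab.
    (* The pair itself shows that the subset is nonempty and contains both [a] and [b]. *)
    destruct (eval_T_domain _ _ _ _ _ Hab) as [ha hb].
    set (B := fun a => eval v w a a).
    set (hB := ex_intro B a ha).
    apply (eval_submodel v B hB u (exist B a ha) (exist B b hb)).
    apply H.
    + split; [now apply hsub |].
      intros [c hc] d E; simpl in E; subst d.
      (* [hw] is used in [v] at the pair [(c, c)]; transferring [T (loop w) (loop w)] to the
         submodel yields [w] at [c] there. *)
      refine (proj1 (eval_T_submodel v w hB (loop w) (exist B c hc)
                       (exist B c hc) _)).
      apply hw; simpl; auto.
    + now apply eval_T_submodel.
  - intros H v [Kv hv] a b Hab.
    apply H; [assumption |].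
    apply eval_T_full; [| assumption].
    intros c; split; [now apply hv | reflexivity].
Qed.
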